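(* Let $q$ be a prime power, let $r$ be an integer with $2\le r\le q$, let $a\in\mathbb{F}_{q^2}^*$, and let $f=aX+X^{r(q-1)+1}\in\mathbb{F}_{q^2}[X]$. Assume that $f$ is a permutation polynomial of $\mathbb{F}_{q^2}$. Then $\gcd(r,q+1)>1$ and $(-a)^{(q+1)/\gcd(r,q+1)}\ne 1$. In particular, if $r$ is a prime, then $q+1\equiv 0\pmod r$ and $(-a)^{(q+1)/r}\ne 1$.
   Context: A polynomial $f\in\mathbb{F}_{Q}[X]$ is a permutation polynomial of $\mathbb{F}_Q$ if the map $x\mapsto f(x)$ is a bijection of $\mathbb{F}_Q$. *)

(* Defs.v *)
From mathcomp Require Import all_boot all_order all_algebra.

Set Implicit Arguments.
Unset Strict Implicit.
Unset Printing Implicit Defensive.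

Import GRing.Theory.
Local Open Scope ring_scope.

Definition prime_power (q : nat) : Prop :=
  exists p k : nat, [/\ prime p, (0 < k)%N & q = (p ^ k)%N].

Definition permutation_polynomial (F : finFieldType) (f : {poly F}) : Prop :=
  bijective (fun x : F => f.[x]).

(* Main.v *)
(** Hermite's criterion with exponent [q - 1]: since [f] permutes [F], the sum of
    [f(x)^(q-1)] over [F] vanishes. In characteristic [p] with [q] a power of [p],
    [(a + y)^(q-1)] is the sum of the [a^(q-1-j) (-y)^j] for [j < q], none of whose
    coefficients vanishes, so this sum is, up to sign, the sum of the terms
    [(-1)^j a^(q-1-j)] over those [j < q] with [q + 1 | 1 + r j].
    When [r] is invertible modulo [q + 1] there is exactly one such [j], the residue
    [j = q] being excluded by [r <> 1 (mod q + 1)], so the sum is nonzero.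
    Finally, if [(-a)^((q+1)/gcd(r,q+1)) = 1] then [-a] is an [r(q-1)]-th power, and
    [f] has a nonzero root besides [0]. *)
Require Import Defs.
From mathcomp Require Import all_boot all_order all_algebra all_fingroup.
From mathcomp Require Import all_solvable all_field zify.

Set Implicit Arguments.
Unset Strict Implicit.
Unset Printing Implicit Defensive.

Import GRing.Theory FinRing.Theory.
Local Open Scope ring_scope.

Lemma finField_prim_root (F : finFieldType) :
  exists z : F, #|F|.-1.-primitive_root z.
Proof.
have F_gt1 := finNzRing_gt1 F.
have /hasP [z _ zP] : has #|F|.-1.-primitive_root (enum (predC1 (0 : F))).
  apply: has_prim_root; rewrite ?enum_uniq //.
  - by rewrite -ltnS prednK // ltnW.
  - apply/allP=> x; rewrite mem_enum inE => x0; rewrite unity_rootE.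
    rewrite -(inj_eq (mulfI x0)) mulr1 -exprS prednK ?expf_card //.
    exact: ltnW.
  - by rewrite -cardE cardC1.
by exists z.
Qed.

(** Multiplication by a primitive root [z] permutes [F] and scales the sum by [z ^+ n], so the sum
    vanishes unless [z ^+ n = 1]. Positivity of [n] makes the term at [0] vanish. *)
Lemma finField_power_sum (F : finFieldType) (n : nat) : (0 < n)%N ->
  \sum_(x : F) x ^+ n = if (#|F|.-1 %| n)%N then -1 else 0.
Proof.
move=> n_gt0; have [z zP] := finField_prim_root F.
have F_gt1 := finNzRing_gt1 F.
have z0 : z != 0 by rewrite (prim_root_eq0 zP) -lt0n -subn1 subn_gt0.
case: ifP => [dvd_n|ndvd_n].
  rewrite (bigD1 0) //= expr0n gtn_eqF // add0r.
  rewrite (eq_bigr (fun=> 1)) => [|x x0]; last first.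
    case/dvdnP: dvd_n => k ->; rewrite mulnC exprM.
    suff -> : x ^+ #|F|.-1 = 1 by rewrite expr1n.
    by apply: (mulfI x0); rewrite mulr1 -exprS prednK ?expf_card // ltnW.
  rewrite sumr_const cardC1; apply/eqP.
  rewrite -subr_eq0 opprK -mulrSr prednK ?(ltnW F_gt1) //.
  (* Lagrange in the additive group of [F]: adding [1] to itself [#|F|] times gives [0]. *)
  have := @expg_cardG _ [set: F]%G (1%R : F) (in_setT _).
  by rewrite cardsT zmodXgE => /eqP.
have zn1 : z ^+ n != 1 by rewrite -(prim_order_dvd zP) ndvd_n.
apply/eqP; move: (zn1); apply: contraNT => S0.
rewrite -(inj_eq (mulIf S0)) mul1r mulr_sumr [eqbRHS](reindex_inj (mulfI z0)) /=.
by apply/eqP/eq_bigr=> x _; rewrite exprMn.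
Qed.

(** Multiplied by [x - y], both sides become [x ^+ n - y ^+ n], by Frobenius on the left. If
    [x = y], the right side is [n] equal terms, and [n] is zero in [F]. *)
Lemma exprB_pchar_pred (F : fieldType) (n : nat) (x y : F) :
  (1 < n)%N -> [pchar F].-nat n ->
  (x - y) ^+ n.-1 = \sum_(i < n) x ^+ (n.-1 - i) * y ^+ i.
Proof.
move=> n_gt1 chF.
have [->|xy] := eqVneq x y.
  rewrite subrr expr0n gtn_eqF ?ltn_predRL //.
  rewrite (eq_bigr (fun=> y ^+ n.-1)) => [|i _]; last first.
    by rewrite -exprD subnK // -ltnS prednK ?ltn_ord // ltnW.
  rewrite sumr_const card_ord -[RHS]mulr_natr.
  have /eqP -> : n%:R == 0 :> F; last by rewrite mulr0.
  apply/negPn; rewrite natf_neq0_pchar; apply/negP => chF'.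
  by rewrite (pnat_1 chF chF') in n_gt1.
have xy0 : x - y != 0 by rewrite subr_eq0.
apply: (mulfI xy0); rewrite -exprS prednK 1?ltnW // -subrXX.
by rewrite exprDn_pchar // exprNn_pchar.
Qed.

Lemma perm_binomial_not_coprime (F : finFieldType) (q r : nat) (a : F) :
  #|F| = (q ^ 2)%N -> [pchar F].-nat q -> (2 <= r <= q)%N -> a != 0 ->
  bijective (fun x : F => a * x + x ^+ (r * (q - 1) + 1)) ->
  ~~ coprime r (q + 1).
Proof.
move=> cF chF /andP [r2 rq] a0 bij; apply/negP => co.
have q2 : (2 <= q)%N by lia.
have sum0 : \sum_(x : F) (a * x + x ^+ (r * (q - 1) + 1)) ^+ q.-1 = 0.
  transitivity (\sum_(y : F) y ^+ q.-1).
    by rewrite [RHS](reindex _ (onW_bij _ bij)).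
  rewrite finField_power_sum ?cF; last by lia.
  (* Here [0 < q - 1 < q ^ 2 - 1], which rules out divisibility. *)
  case: ifP => // /dvdn_leq; nia.
have expand (x : F) : (a * x + x ^+ (r * (q - 1) + 1)) ^+ q.-1 =
    \sum_(j < q) a ^+ (q.-1 - j) * (-1) ^+ j * x ^+ ((q - 1) * (1 + r * j)).
  have -> : a * x + x ^+ (r * (q - 1) + 1) = x * (a - - x ^+ (r * (q - 1))).
    by rewrite opprK mulrDr mulrC addn1 exprS.
  rewrite exprMn exprB_pchar_pred // mulr_sumr; apply: eq_bigr => j _.
  rewrite (exprNn (x ^+ _)) mulnDr muln1 mulnA (mulnC _ r) subn1 exprD.
  by rewrite [x ^+ (_ * j)]exprM mulrCA -[RHS]mulrA; congr (_ * _); exact: mulrCA.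
have dvd_j j : (#|F|.-1 %| (q - 1) * (1 + r * j))%N = (q + 1 %| 1 + r * j)%N.
  have -> : (#|F|.-1 = (q - 1) * (q + 1))%N by rewrite cF; nia.
  by rewrite dvdn_pmul2l // subn_gt0.
have exp_gt0 j : (0 < (q - 1) * (1 + r * j))%N by rewrite muln_gt0 subn_gt0 q2.
have [j0 j0q dvd_j0] : exists2 j0, (j0 < q)%N & (q + 1 %| 1 + r * j0)%N.
  have /coprimeP [|[u v] /= uv1] := co; first by lia.
  (* Bezout makes [u] an inverse of [r] modulo [q + 1]; since [q] is congruent to -1, [q * u]
     represents minus that inverse. *)
  pose j := ((q * u) %% (q + 1))%N.
  have dj : (q + 1 %| 1 + r * j)%N.
    rewrite /dvdn -modnDmr modnMmr modnDmr.
    have -> : (1 + r * (q * u) = (1 + q * v) * (q + 1))%N by nia.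
    by rewrite modnMl.
  exists j => //; have : (j < q + 1)%N by rewrite ltn_mod addn1.
  rewrite addn1 ltnS leq_eqVlt => /orP [/eqP jq|//]; exfalso.
  have : (q + 1 %| r - 1)%N.
    have := dvdn_mull r (dvdnn (q + 1)).
    have -> : (r * (q + 1) = 1 + r * q + (r - 1))%N by nia.
    by rewrite -{2}jq dvdn_addr.
  by move/dvdn_leq; lia.
(* Subtracting the two multiples, [q + 1] divides [(j - i) * r], hence [j - i], which is too small
   unless zero. The order of [i] and [j] keeps the natural subtraction exact. *)
have uniq_j i j : (i <= j < q)%N -> (q + 1 %| 1 + r * i)%N ->
    (q + 1 %| 1 + r * j)%N -> i = j.
  move=> /andP [le_ij jq] di.
  have -> : (1 + r * j = 1 + r * i + (j - i) * r)%N by nia.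
  rewrite dvdn_addr // Gauss_dvdl 1?coprime_sym // => dij.
  have [|/dvdn_leq /(_ dij)] := posnP (j - i); lia.
move/eqP: sum0; apply/negP.
under eq_bigr => x _ do rewrite expand.
rewrite exchange_big /= (bigD1 (Ordinal j0q)) //= -mulr_sumr.
rewrite finField_power_sum //= dvd_j dvd_j0.
rewrite big1 ?addr0 => [|j neq_j].
  by rewrite !mulf_neq0 ?expf_neq0 ?oppr_eq0 ?oner_eq0.
rewrite -mulr_sumr finField_power_sum // dvd_j.
case: ifP => [dvd_j1|_]; last by rewrite mulr0.
case/eqP: neq_j; apply: val_inj => /=.
by case: (leqP j j0) => le_j; [|apply/esym];
  apply: uniq_j; rewrite // ?le_j ?(ltnW le_j) /=.
Qed.

(** For [z] a generator of the nonzero elements, [z ^+ (r * (q - 1))] has order exactly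
    [(q + 1) %/ gcdn r (q + 1)], so [- a] is its [i]-th power for some [i], and [z ^+ i] is the
    root. *)
Lemma binomial_nonzero_root (F : finFieldType) (q r : nat) (a : F) :
  #|F| = (q ^ 2)%N -> (0 < r)%N ->
  (- a) ^+ ((q + 1) %/ gcdn r (q + 1)) = 1 ->
  exists2 x : F, x != 0 & a * x + x ^+ (r * (q - 1) + 1) = 0.
Proof.
move=> cF r0 a1; have [z zP] := finField_prim_root F.
have q1 : (1 < q)%N by have := finNzRing_gt1 F; rewrite cF; nia.
have z0 : z != 0 by rewrite (prim_root_eq0 zP) cF; nia.
have := exp_prim_root zP (r * (q - 1)).
have -> : (#|F|.-1 = (q + 1) * (q - 1))%N by rewrite cF; nia.
rewrite -muln_gcdl divnMr; last by lia.
move=> wP; have [i iE] := prim_rootP wP a1.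
exists (z ^+ i); first by rewrite expf_neq0.
rewrite [(r * _ + 1)%N]addn1 exprS mulrC -mulrDr -exprM mulnC exprM -iE subrr.
by rewrite mulr0.
Qed.

Theorem theorem1p4 (q : nat) (hq : prime_power q) (r : nat)
  (hr : (2 <= r <= q)%N) (F : finFieldType) (hF : #|F| = (q ^ 2)%N)
  (a : F) (ha : a != 0)
  (hf : permutation_polynomial (a *: 'X + 'X^(r * (q - 1) + 1))) :
  [/\ (1 < gcdn r (q + 1))%N,
      (- a) ^+ ((q + 1) %/ gcdn r (q + 1)) <> 1
    & prime r ->
        q + 1 = 0 %[mod r] /\ (- a) ^+ ((q + 1) %/ r) <> 1].
Proof.
have fE x : (a *: 'X + 'X^(r * (q - 1) + 1)).[x] = a * x + x ^+ (r * (q - 1) + 1).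
  by rewrite hornerE hornerZ hornerX hornerXn.
have bij : bijective (fun x : F => a * x + x ^+ (r * (q - 1) + 1)).
  exact: (eq_bij hf fE).
have chF : [pchar F].-nat q.
  case: hq => p [k [pr_p _ qE]].
  have pP : p \in [pchar F].
    by apply: (@card_finPcharP _ p (k * 2)) => //; rewrite hF qE expnM.
  by rewrite (eq_pnat _ (pcharf_eq pP)) qE pnatX pnat_id.
have gcd_gt1 : (1 < gcdn r (q + 1))%N.
  have := perm_binomial_not_coprime hF chF hr ha bij.
  by rewrite /coprime; have := gcdn_gt0 r (q + 1); lia.
have a_neq1 : (- a) ^+ ((q + 1) %/ gcdn r (q + 1)) <> 1.
  move=> a1; have [|x /eqP x0 fx0] := binomial_nonzero_root hF _ a1; first by lia.
  by apply/x0/(bij_inj bij); rewrite fx0 mulr0 add0r expr0n addn1.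
split=> // pr_r.
have dvd_r : (r %| q + 1)%N.
  (* A prime not dividing [q + 1] would be coprime to it. *)
  by apply: contraTT gcd_gt1; rewrite -prime_coprime // /coprime => /eqP ->.
split; first by rewrite mod0n; apply/eqP.
by have /gcdn_idPl <- := dvd_r.
Qed.
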